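(* Let $1\le m\le p$ and let $\mathbf{R}=[\mathbf{r}_1,\dots,\mathbf{r}_m]\in\mathbb{R}^{p\times m}$ be a random sampling matrix whose $m$ columns are chosen uniformly at random without replacement from the set of all $p$ canonical basis vectors of $\mathbb{R}^p$. Then the columns of $\mathbf{R}$ are orthonormal, i.e. $\mathbf{R}^T\mathbf{R}=\mathbf{I}_m$. Moreover, $$\mathbb{E}[\mathbf{R}\mathbf{R}^T]=\frac mp\mathbf{I}_p,$$ and for any fixed vector $\mathbf{x}\in\mathbb{R}^p$ and $m\ge2$, $$\mathbb{E}[\mathbf{R}\mathbf{R}^T\mathbf{x}\mathbf{x}^T\mathbf{R}\mathbf{R}^T]=\frac{m(m-1)}{p(p-1)}\mathbf{x}\mathbf{x}^T+\frac{m(p-m)}{p(p-1)}\,\mathrm{diag}(\mathbf{x}\mathbf{x}^T).$$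
   Context: For a square matrix $\mathbf{A}$, $\mathrm{diag}(\mathbf{A})$ is the matrix obtained by zeroing all off-diagonal entries. $\mathbf{I}_p$ denotes the $p\times p$ identity matrix. *)

(* Defs.v *)
From HB Require Import structures.
From mathcomp Require Import all_boot all_order all_algebra.
From mathcomp Require Import all_classical all_reals all_analysis.

Set Implicit Arguments.
Unset Strict Implicit.
Unset Printing Implicit Defensive.

Import Order.TTheory GRing.Theory Num.Theory.
Import numFieldNormedType.Exports.

Local Open Scope classical_set_scope.
Local Open Scope ring_scope.

Definition diag_part (R : realType) (n : nat) (A : 'M[R]_n) : 'M[R]_n :=
  \matrix_(i, j) (if i == j then A i j else 0).

(* The possible outcomes of a draw without replacement: every column is a
   canonical basis vector and no basis vector is drawn twice. *)
Definition basis_selection (R : realType) (p m : nat) (A : 'M[R]_(p, m)) : Prop :=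
  (forall j : 'I_m, exists k : 'I_p, col j A = delta_mx k ord0) /\
  injective (fun j : 'I_m => col j A).

(* There are p ^_ m = p (p - 1) ... (p - m + 1) ordered selections, all equally
   likely.  The values of S are selections at every sample point, not only
   almost surely. *)
Definition uniform_sampling_matrix d (T : measurableType d) (R : realType)
    (P : probability T R) (p m : nat) (S : T -> 'M[R]_(p, m)) : Prop :=
  [/\ forall (i : 'I_p) (j : 'I_m), measurable_fun [set: T] (fun w => S w i j),
      forall w, basis_selection (S w) &
      forall A : 'M[R]_(p, m), basis_selection A ->
        P [set w | S w = A] = ((p ^_ m)%:R^-1)%:E].

(* The entries are the extended-real expectations of the library, so an equation
   between mx_expectation and a real matrix also says that they are finite. *)
Definition mx_expectation d (T : measurableType d) (R : realType)
    (P : probability T R) (p q : nat) (X : T -> 'M[R]_(p, q)) : 'M[\bar R]_(p, q) :=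
  \matrix_(i, j) expectation P (fun w => X w i j).

(* Main.v *)
(** A selection matrix S is given by an injection f of the column indices into
    the row indices, and S S^T is the diagonal matrix whose entries are the
    indicators of the image of f.  Both expectations thus reduce to the
    numbers N i j of injections whose image contains i and j.  Permuting the
    row indices shows that N takes one value on the diagonal and one value off
    it; since every image has m elements, double counting gives
    \sum_i N i i = m p^_m and \sum_i \sum_j N i j = m^2 p^_m, which determine
    both values. *)

Require Import Defs.
From HB Require Import structures.
From mathcomp Require Import all_boot all_order all_algebra fingroup perm ring.
From mathcomp Require Import all_classical all_reals all_analysis.

Set Implicit Arguments.
Unset Strict Implicit.
Unset Printing Implicit Defensive.

Import Order.TTheory GRing.Theory Num.Theory.
Import numFieldNormedType.Exports.

Local Open Scope classical_set_scope.
Local Open Scope ring_scope.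

(** [F \o Z] is a finite combination of indicators of the fibres of [Z], integrated term by term.
    Measurability is asked of the fibres, since [I] carries no sigma-algebra. *)
Lemma expectation_fin d (T : measurableType d) (R : realType)
    (P : probability T R) (I : finType) (Z : T -> I) (F : I -> R) :
  (forall i, measurable [set w | Z w = i]) ->
  expectation P (F \o Z) = (\sum_i (F i)%:E * P [set w | Z w = i])%E.
Proof.
move=> mZ; rewrite unlock.
transitivity (\int[P]_w \sum_i (F i)%:E * (\1_[set w | Z w = i] w)%:E)%E.
  apply: eq_integral => w _; rewrite (bigD1 (Z w)) //= big1 => [|i iZ].
    by rewrite indicE mem_set // mule1 adde0.
  by rewrite indicE memNset ?mule0// => /esym/eqP; rewrite (negbTE iZ).
have intZ i : P.-integrable [set: T] (EFin \o \1_[set w | Z w = i]).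
  exact: integrable_indic.
rewrite integral_sum//; last by move=> i; apply: integrableZl => //; exact: intZ.
by apply: eq_bigr => i _; rewrite (integralZl _ (intZ i))// integral_indic// setIT.
Qed.

Lemma measurable_mx_fiber d (T : measurableType d) (R : realType) (p m : nat)
    (S : T -> 'M[R]_(p, m)) (A : 'M[R]_(p, m)) :
  (forall i j, measurable_fun [set: T] (fun w => S w i j)) ->
  measurable [set w | S w = A].
Proof.
move=> mS.
have -> : [set w | S w = A] =
    \bigcap_(ij in [set: 'I_p * 'I_m])
      ((fun w => S w ij.1 ij.2) @^-1` [set A ij.1 ij.2]).
  apply/seteqP; split=> [w /= <- [] //|w /= Sw].
  by apply/matrixP => i j; exact: (Sw (i, j)).
apply: fin_bigcap_measurable => // -[i j] _ /=.
by rewrite -[_ @^-1` _]setTI; apply: mS.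
Qed.

(** A finite function as index makes the possible outcomes a finite type, over which expectations
    become sums. *)
Definition selection_mx (R : realType) (p m : nat) (f : {ffun 'I_m -> 'I_p}) :
    'M[R]_(p, m) := \matrix_(k, j) (k == f j)%:R.

Section Selection.
Variables (R : realType) (p m : nat).
Implicit Types f : {ffun 'I_m -> 'I_p}.

Lemma col_selection_mx f j :
  col j (selection_mx R f) = delta_mx (f j) ord0.
Proof. by apply/matrixP => k l; rewrite !mxE ord1 andbT. Qed.

Lemma delta_col_inj : injective (fun k : 'I_p => delta_mx k ord0 : 'cV[R]_p).
Proof.
move=> k l /matrixP/(_ k ord0); rewrite !mxE !eqxx /= andbT.
by case: eqP => // _ /eqP; rewrite oner_eq0.
Qed.

Lemma selection_mx_inj : injective (@selection_mx R p m).
Proof.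
move=> f g fg; apply/ffunP => j; apply: delta_col_inj.
by rewrite /= -!col_selection_mx fg.
Qed.

Lemma basis_selection_mx f :
  basis_selection (selection_mx R f) <-> injective f.
Proof.
split=> [[_ cI] j k fjk|fI]; first by apply: cI; rewrite !col_selection_mx fjk.
split=> [j|j k]; first by exists (f j); rewrite col_selection_mx.
by rewrite !col_selection_mx => /delta_col_inj/fI.
Qed.

Lemma basis_selectionP (A : 'M[R]_(p, m)) :
  basis_selection A -> exists f, A = selection_mx R f.
Proof.
move=> [/choice[f Af] _]; exists (finfun f).
apply/matrixP => k j; have /matrixP/(_ k ord0) := Af j.
by rewrite !mxE ffunE andbT.
Qed.

Lemma selection_mx_orthonormal f : injective f ->
  (selection_mx R f)^T *m selection_mx R f = 1%:M.
Proof.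
move=> fI; apply/matrixP => j k; rewrite !mxE (bigD1 (f j)) //= big1.
  by rewrite !mxE eqxx mul1r addr0 (inj_eq fI).
by move=> i ij; rewrite !mxE (negbTE ij) mul0r.
Qed.

(** The entry at [(i, k)] sums the products of the indicators of [i = f j] and [k = f j];
    injectivity leaves at most one [j] with [i = f j]. *)
Lemma selection_mx_proj f : injective f ->
  selection_mx R f *m (selection_mx R f)^T
    = diag_mx (\row_i (i \in codom f)%:R).
Proof.
move=> fI; apply/matrixP => i k; rewrite !mxE.
case: (boolP (i \in codom f)) => [/codomP[j ->]|inf].
  rewrite (bigD1 j) //= big1 => [|l lj]; rewrite !mxE.
    by rewrite eqxx mul1r addr0 eq_sym.
  by rewrite (inj_eq fI) eq_sym (negbTE lj) mul0r.
rewrite big1 ?mul0rn// => j _; rewrite !mxE.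
by case: eqP inf => [->|]; rewrite ?codom_f ?mul0r.
Qed.

(** The count [N i j], written in [R] as a sum of products of indicators, the form in which the
    entries of the expectations produce it. *)
Definition joint_count (i j : 'I_p) : R :=
  \sum_(f : {ffun 'I_m -> 'I_p} | injectiveb f)
    ((i \in codom f)%:R * (j \in codom f)%:R).

(** Composition with [s] permutes the injections and moves their images by [s]. *)
Lemma joint_count_perm (s : {perm 'I_p}) i j :
  joint_count (s i) (s j) = joint_count i j.
Proof.
pose act (t : {perm 'I_p}) f : {ffun 'I_m -> 'I_p} := [ffun k => t (f k)].
have codom_act f k : (s k \in codom (act s f)) = (k \in codom f).
  apply/codomP/codomP => -[l]; first by rewrite ffunE => /perm_inj ->; exists l.
  by move=> ->; exists l; rewrite ffunE.
rewrite /joint_count (reindex (act s)) /=; last first.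
  by exists (act s^-1%g) => f _; apply/ffunP => k; rewrite !ffunE ?permK ?permKV.
apply: eq_big => [f|f _]; last by rewrite !codom_act.
apply/injectiveP/injectiveP => fI k l; last first.
  by rewrite !ffunE => /perm_inj/fI.
by move=> fkl; apply: fI; rewrite !ffunE fkl.
Qed.

Lemma joint_count_diag i j : joint_count i i = joint_count j j.
Proof. by rewrite -(joint_count_perm (tperm i j)) tpermL. Qed.

Lemma joint_count_offdiag i j k l : i != j -> k != l ->
  joint_count i j = joint_count k l.
Proof.
move=> ij kl; rewrite -(joint_count_perm (tperm i k)) tpermL.
(* The first transposition sends [(i, j)] to [(k, j')]; the one swapping [j'] and [l] fixes [k],
   which differs from both. *)
set j' := tperm i k j.
have j'k : j' != k by rewrite -(tpermL i k) (inj_eq perm_inj) eq_sym.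
by rewrite -(joint_count_perm (tperm j' l)) tpermL tpermD// eq_sym.
Qed.

Lemma sum_codom f : injective f -> \sum_i (i \in codom f)%:R = m%:R :> R.
Proof.
move=> fI; rewrite -natr_sum; congr _%:R.
rewrite -[RHS](card_ord m) -(card_codom fI) -sum1_card [RHS]big_mkcond /=.
by apply: eq_bigr => i _; case: (i \in _).
Qed.

Lemma sum1_injective :
  \sum_(f : {ffun 'I_m -> 'I_p} | injectiveb f) 1 = (p ^_ m)%:R :> R.
Proof.
rewrite sumr_const; congr _%:R.
by have := card_inj_ffuns 'I_m 'I_p; rewrite cardsE !card_ord.
Qed.

Lemma sum_joint_count_diag : \sum_i joint_count i i = m%:R * (p ^_ m)%:R.
Proof.
rewrite exchange_big /= -sum1_injective mulr_sumr.
apply: eq_bigr => f /injectiveP fI.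
rewrite mulr1 -(sum_codom fI); apply: eq_bigr => i _.
by case: (i \in _); rewrite ?mulr1 ?mulr0.
Qed.

(** After exchanging sums, each injection contributes the number of ordered pairs in its image, the
    square of [m]. *)
Lemma sum_joint_count :
  \sum_i \sum_j joint_count i j = m%:R ^+ 2 * (p ^_ m)%:R.
Proof.
under eq_bigr => i _ do rewrite exchange_big /=.
rewrite exchange_big /= -sum1_injective mulr_sumr.
apply: eq_bigr => f /injectiveP fI.
rewrite mulr1 expr2 -(sum_codom fI) mulr_suml; apply: eq_bigr => i _.
by rewrite mulr_sumr.
Qed.

Lemma joint_count_diagE i : p%:R * joint_count i i = m%:R * (p ^_ m)%:R.
Proof.
rewrite -sum_joint_count_diag (eq_bigr (fun=> joint_count i i)); last first.
  by move=> j _; exact: joint_count_diag.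
by rewrite sumr_const card_ord mulr_natl.
Qed.

(** Each row sum is the diagonal value plus [p - 1] times the off-diagonal one; subtracting the
    diagonal total from the full total isolates the latter. *)
Lemma joint_count_offdiagE i j : i != j ->
  p%:R * (p%:R - 1) * joint_count i j = m%:R * (m%:R - 1) * (p ^_ m)%:R.
Proof.
move=> ij.
have rowE k : \sum_l joint_count k l
    = joint_count k k + (p%:R - 1) * joint_count i j.
  rewrite (bigD1 k) //=; congr (_ + _).
  rewrite (eq_bigr (fun=> joint_count i j)); last first.
    by move=> l lk; apply: joint_count_offdiag => //; rewrite eq_sym.
  rewrite sumr_const cardC1 card_ord -[LHS]mulr_natl; congr (_ * _).
  (* The element [i] excludes [p = 0], where the truncated predecessor would differ from [p - 1] in
     [R]. *)
  by case: p i {ij j k} => [[]//|n _]; rewrite /= -natr1 addrK.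
have := sum_joint_count; under eq_bigr do rewrite rowE.
rewrite big_split /= sum_joint_count_diag sumr_const card_ord.
rewrite -[X in _ + X]mulr_natl => E.
by apply: (addrI (m%:R * (p ^_ m)%:R)); rewrite -mulrA E; ring.
Qed.

End Selection.

Lemma expectation_sampling d (T : measurableType d) (R : realType)
    (P : probability T R) (p m : nat) (S : T -> 'M[R]_(p, m))
    (hS : uniform_sampling_matrix P S) (g : 'M[R]_(p, m) -> R) :
  expectation P (fun w => g (S w)) =
    ((p ^_ m)%:R^-1 * \sum_(f : {ffun 'I_m -> 'I_p} | injectiveb f)
       g (selection_mx R f))%:E.
Proof.
case: hS => mS bS uS.
(* [Z] comes from choice, but injectivity of [selection_mx] identifies its fibres with those of [S],
   hence they are measurable. *)
have [Z SZ] := choice (fun w => basis_selectionP (bS w)).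
have fibZ f : [set w | Z w = f] = [set w | S w = selection_mx R f].
  by apply/seteqP; split=> w /=; rewrite SZ; [move->|move/selection_mx_inj].
have -> : (fun w => g (S w)) = (g \o selection_mx R (m:=m)) \o Z.
  by apply/funext => w /=; rewrite SZ.
rewrite expectation_fin; last first.
  by move=> f; rewrite fibZ; exact: measurable_mx_fiber.
rewrite (bigID (fun f : {ffun _} => injectiveb f)) /=.
rewrite [X in (_ + X)%E]big1.
  rewrite adde0 mulr_sumr -sumEFin; apply: eq_bigr => f /injectiveP fI.
  rewrite fibZ uS; last exact/basis_selection_mx.
  by rewrite -EFinM mulrC.
(* Every value of [S] is a selection, so a non-injective [f] has an empty fibre. *)
move=> f fNI; suff -> : [set w | Z w = f] = set0 by rewrite measure0 mule0.
apply/seteqP; split=> // w /= Zw; move/injectiveP: fNI; apply.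
by apply/(basis_selection_mx R); rewrite -Zw -SZ.
Qed.

Theorem theoremB4 (R : realType) (d : measure_display) (T : measurableType d)
    (P : probability T R) (p m : nat) (hm : (1 <= m)%N) (hmp : (m <= p)%N)
    (S : T -> 'M[R]_(p, m)) (hS : uniform_sampling_matrix P S) :
  [/\ forall w : T, (S w)^T *m S w = 1%:M,
      mx_expectation P (fun w => S w *m (S w)^T)
        = map_mx EFin ((m%:R / p%:R) *: 1%:M) &
      forall x : 'cV[R]_p, (2 <= m)%N ->
        mx_expectation P
            (fun w => S w *m (S w)^T *m x *m x^T *m S w *m (S w)^T)
        = map_mx EFin
            ((m%:R * (m%:R - 1) / (p%:R * (p%:R - 1))) *: (x *m x^T)
             + (m%:R * (p%:R - m%:R) / (p%:R * (p%:R - 1)))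
                 *: diag_part (x *m x^T))].
Proof.
have N0 : (p ^_ m)%:R != 0 :> R by rewrite pnatr_eq0 -lt0n ffact_gt0.
have p0 : p%:R != 0 :> R by rewrite pnatr_eq0 -lt0n (leq_trans hm hmp).
have diagE (i : 'I_p) : joint_count R m i i = m%:R / p%:R * (p ^_ m)%:R :> R.
  apply: (mulfI p0); rewrite joint_count_diagE.
  by field.
split=> [w||x m2].
- case: hS => _ bS _; have [f Sf] := basis_selectionP (bS w).
  have := bS w; rewrite Sf => /basis_selection_mx fI.
  exact: selection_mx_orthonormal.
- apply/matrixP => i j; rewrite !mxE.
  rewrite (expectation_sampling hS (fun A => (A *m A^T) i j)); congr EFin.
  (* The projection is diagonal, and its diagonal indicators equal their squares. *)
  transitivity ((p ^_ m)%:R^-1 * (joint_count R m i i *+ (i == j))).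
    congr (_ * _); rewrite -sumrMnl; apply: eq_bigr => f /injectiveP fI.
    rewrite selection_mx_proj // !mxE.
    by case: (i \in _); rewrite ?mulr1 ?mulr0.
  rewrite diagE; case: (i == j); rewrite ?mulr0n ?mulr1n ?mulr0 ?mulr1 //.
  by field; rewrite N0 p0.
apply/matrixP => i j; rewrite !mxE.
rewrite (expectation_sampling hS
  (fun A => (A *m A^T *m x *m x^T *m A *m A^T) i j)); congr EFin.
have p1 : p%:R - 1 != 0 :> R.
  by rewrite subr_eq0 -[1]/(1%:R) eqr_nat neq_ltn (leq_trans m2 hmp) orbT.
transitivity ((p ^_ m)%:R^-1 * (joint_count R m i j * (x i ord0 * x j ord0))).
  congr (_ * _); rewrite mulr_suml; apply: eq_bigr => f /injectiveP fI.
  (* Reassociating exposes the diagonal projection on both sides of [x *m x^T]: it scales row [i]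
     and column [j] by the indicators of [i] and [j]. *)
  rewrite -[_ *m selection_mx R f *m _]mulmxA selection_mx_proj //.
  rewrite -[_ *m x *m x^T]mulmxA mul_mx_diag mul_diag_mx !mxE big_ord1 !mxE.
  by ring.
rewrite big_ord1 !mxE.
(* On the diagonal the two coefficients add up to [m / p], as [m (m - 1) + m (p - m) = m (p - 1)];
   off it [diag_part] vanishes. *)
case: (eqVneq i j) => [<-|ij].
  by rewrite diagE; field; rewrite N0 p0 p1.
have -> : joint_count R m i j
    = m%:R * (m%:R - 1) / (p%:R * (p%:R - 1)) * (p ^_ m)%:R.
  apply: (mulfI (mulf_neq0 p0 p1)); rewrite (joint_count_offdiagE R m ij).
  by field; rewrite p0 p1.
by field; rewrite N0 p0 p1.
Qed.
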